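(* Let $p\ge 1$ be real, let $\mathscr{I}\subseteq\mathbb{R}$ be an interval, and let $\{K_t\}_{t\in\mathscr{I}}$ be a parallel chord movement in $\mathbb{R}^n$ such that $K_t\in\mathcal{K}^n_0$ for all $t\in\mathscr{I}$. Then $t\mapsto F_p(K_t)$ is a convex function on $\mathscr{I}$.
   Context: A convex body in $\mathbb{R}^n$ is a non-empty compact convex subset of $\mathbb{R}^n$; its support function is $h_K(u)=\sup\{\langle x,u\rangle : x\in K\}$, $u\in\mathbb{R}^n$. For a real number $p\ge 1$ and convex bodies $K,L\subset\mathbb{R}^n$ both containing the origin, the $p$-sum $K+_pL$ is the convex body whose support function is $h_{K+_pL}(u)=\big(h_K(u)^p+h_L(u)^p\big)^{1/p}$, $u\in\mathbb{R}^n$. Write $-K=\{-x: x\in K\}$ and let $V_n$ denote $n$-dimensional volume (Lebesgue measure). $\mathcal{K}^n_0$ denotes the set of convex bodies in $\mathbb{R}^n$ with non-empty interior and containing the origin. For $K\in\mathcal{K}^n_0$, $$F_p(K)=\frac{V_n\big(K+_p(-K)\big)}{V_n(K)}.$$ A parallel chord movement is a family $\{K_t\}_{t\in\mathscr{I}}$ of convex bodies, indexed by an interval $\mathscr{I}\subseteq\mathbb{R}$, of the form $$K_t=\{x+\beta(x|v^{\perp})\,t\,v : x\in K\},\qquad t\in\mathscr{I},$$ where $K\subset\mathbb{R}^n$ is a fixed convex body, $v\in\mathbb{R}^n\setminus\{0\}$ is a fixed direction, $x|v^{\perp}$ is the orthogonal projection of $x$ onto the hyperplane $v^{\perp}$,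 $\beta$ is a bounded real-valued function on the orthogonal projection of $K$ onto $v^{\perp}$, and convexity is preserved, i.e. the set $\{x+\beta(x|v^{\perp})\,t\,v : x\in K\}$ is convex for every $t\in\mathscr{I}$. *)

(* Defs.v *)
From HB Require Import structures.
From mathcomp Require Import all_boot all_order all_algebra.
From mathcomp Require Import all_classical all_reals all_analysis.

Set Implicit Arguments.
Unset Strict Implicit.
Unset Printing Implicit Defensive.
Import Order.TTheory GRing.Theory Num.Theory.
Import numFieldNormedType.Exports.
Local Open Scope classical_set_scope.
Local Open Scope ring_scope.

(* The n-fold product of m with itself, on n-tuples: the library only has binary
   product measures. *)
Section tuple_measure.
Context d (T : measurableType d) (R : realType).

Definition cons_pair n (x : T * n.-tuple T) : n.+1.-tuple T :=
  [the n.+1.-tuple T of x.1 :: x.2].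

Definition uncons_pair n (t : n.+1.-tuple T) : T * n.-tuple T :=
  (thead t, [tuple of behead t]).

Lemma cons_pairK n : cancel (@cons_pair n) (@uncons_pair n).
Proof. by case=> x t; congr pair; apply/val_inj. Qed.

Lemma uncons_pairK n : cancel (@uncons_pair n) (@cons_pair n).
Proof. by move=> t; rewrite [RHS]tuple_eta; apply/val_inj. Qed.

Lemma measurable_cons_pair n :
  measurable_fun [set: T * n.-tuple T] (@cons_pair n).
Proof. exact: measurable_cons. Qed.

Lemma measurable_uncons_pair n :
  measurable_fun [set: n.+1.-tuple T] (@uncons_pair n).
Proof.
apply/measurable_fun_pairP; split; first exact: measurable_tnth.
apply/measurable_fun_tnthP => i.
rewrite (_ : _ \o _ = @tnth n.+1 T ^~ (lift ord0 i)).
  exact: measurable_tnth.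
apply/funext => t /=; rewrite tnth_behead; congr tnth.
by apply/val_inj; rewrite /= inordK// ltnS.
Qed.

Section step.
Context (m : {sigma_finite_measure set T -> \bar R}).
Context n (mn : {sigma_finite_measure set (n.-tuple T) -> \bar R}).

Definition tuple_measureS : set (n.+1.-tuple T) -> \bar R :=
  pushforward (m \x mn)%E (@cons_pair n).

Let tuple_measureS0 : tuple_measureS set0 = 0%E.
Proof. by rewrite /tuple_measureS /pushforward preimage_set0 measure0. Qed.

Let tuple_measureS_ge0 A : (0 <= tuple_measureS A)%E.
Proof. exact: (measure_ge0 (m \x mn)%E). Qed.

Let tuple_measureS_sigma_additive : semi_sigma_additive tuple_measureS.
Proof.
have := @measure_semi_sigma_additive _ _ _
  (measure_function_pushforward__canonical__measure_function_Measure
     (m \x mn)%E (@measurable_cons_pair n)).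
exact.
Qed.

HB.instance Definition _ := isMeasure.Build _ _ _ tuple_measureS
  tuple_measureS0 tuple_measureS_ge0 tuple_measureS_sigma_additive.

Let tuple_measureS_sigma_finite : sigma_finite setT tuple_measureS.
Proof.
have /sigma_finiteP[F [TF ndF Foo]] := sigma_finiteT m.
have /sigma_finiteP[G [TG ndG Goo]] := sigma_finiteT mn.
exists (fun k => @uncons_pair n @^-1` (F k `*` G k)).
  apply/seteqP; split=> // t _.
  have [k _ Fk] : (\bigcup_k F k) (uncons_pair t).1 by rewrite -TF.
  have [l _ Gl] : (\bigcup_l G l) (uncons_pair t).2 by rewrite -TG.
  exists (maxn k l) => //; split.
  - by move: Fk; exact/subsetPset/ndF/leq_maxl.
  - by move: Gl; exact/subsetPset/ndG/leq_maxr.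
move=> k; have [mF Fk] := Foo k; have [mG Gk] := Goo k; split.
  rewrite -[X in measurable X]setTI; apply: measurable_uncons_pair => //.
  exact: measurableX.
rewrite /tuple_measureS /pushforward -comp_preimage.
rewrite (_ : _ \o _ = id) ?preimage_id; last first.
  by apply/funext => x /=; rewrite cons_pairK.
by rewrite product_measure1E// lte_mul_pinfty// ge0_fin_numE.
Qed.

HB.instance Definition _ := Measure_isSigmaFinite.Build _ _ _ tuple_measureS
  tuple_measureS_sigma_finite.
End step.

Fixpoint tuple_measure (m : {sigma_finite_measure set T -> \bar R}) n :
    {sigma_finite_measure set (n.-tuple T) -> \bar R} :=
  match n with
  | 0 => @dirac _ (0.-tuple T) [tuple] R
  | n'.+1 => tuple_measureS m (tuple_measure m n')
  end.

End tuple_measure.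

Lemma tuple_measure_box d (T : measurableType d) (R : realType)
    (m : {sigma_finite_measure set T -> \bar R}) n (A : 'I_n -> set T) :
  (forall i, measurable (A i)) ->
  tuple_measure m n [set t | forall i, A i (tnth t i)] =
  (\prod_(i < n) m (A i))%E.
Proof.
elim: n => [|n IHn] in A * => mA /=.
  rewrite big_ord0 diracE mem_set//; by case.
pose B := [set t : n.-tuple T | forall i, A (lift ord0 i) (tnth t i)].
have mB : measurable B.
  have -> : B = \bigcap_(i in [set: 'I_n])
      ((@tnth n T ^~ i) @^-1` A (lift ord0 i)).
    by apply/seteqP; split=> t Bt i; [move=> _; exact: Bt|exact: Bt].
  apply: fin_bigcap_measurable => // i _.
  by rewrite -[X in measurable X]setTI; exact: measurable_tnth.
rewrite big_ord_recl -IHn// -product_measure1E//.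
congr product_measure1; apply/seteqP; split=> [[x t] /= xtA|[x t] /= [xA tA] i].
  split=> [|i]; first exact: xtA ord0.
  by have := xtA (lift ord0 i); rewrite tnthS.
by case: (unliftP ord0 i) => [j ->|->]//; rewrite tnthS.
Qed.

Definition lebesgue_measure_tuple (R : realType) (n : nat) :=
  tuple_measure (@lebesgue_measure R) n.

Section convex_bodies.
Context (R : realType) (n : nat).
Implicit Types (x u v : 'rV[R]_n) (K L : set 'rV[R]_n) (p : R).

(* 'rV[R]_n has no measurable structure in the library, so a set of row vectors
   is measured through the set of tuples of its coordinates. *)
Definition volume K : \bar R :=
  lebesgue_measure_tuple R n [set t | K (\row_i tnth t i)].

Definition dotrv x u : R := \sum_i x ord0 i * u ord0 i.

Definition convex_body K := [/\ K !=set0, compact K & convex_set K].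

(* The class K^n_0. *)
Definition convex_body0 K := [/\ convex_body K, K^° !=set0 & K 0].

Definition support_fun K u : R := sup [set dotrv x u | x in K].

Definition reflection K := [set - x | x in K].

Definition is_psum p K L M :=
  convex_body M /\
  forall u, support_fun M u =
    (support_fun K u `^ p + support_fun L u `^ p) `^ p^-1.

(* For 1 <= p and convex bodies K, L containing 0, exactly one M satisfies
   is_psum p K L M, and psum p K L is that M; outside this case the value may be
   junk. *)
Definition psum p K L : set 'rV[R]_n := get (is_psum p K L).

Definition Fp p K : R :=
  fine (volume (psum p K (reflection K))) / fine (volume K).

(* Orthogonal projection onto the hyperplane orthogonal to v (for v != 0). *)
Definition hyperproj v x := x - (dotrv x v / dotrv v v) *: v.

(* beta only matters on the projection of K, the only place where it is required
   to be bounded and where it is evaluated. That convexity is preserved is part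
   of convex_body (Kt t). *)
Definition parallel_chord_movement (I : set R) (Kt : R -> set 'rV[R]_n) :=
  exists (K : set 'rV[R]_n) (v : 'rV[R]_n) (beta : 'rV[R]_n -> R),
    [/\ convex_body K, v != 0, [bounded beta y : R^o | y in hyperproj v @` K] &
        forall t, I t ->
          Kt t = [set x + (beta (hyperproj v x) * t) *: v | x in K] /\
          convex_body (Kt t)].

End convex_bodies.

(* Main.v *)
(** Since [lp_sum], the set of all [a x + b y] with [x] in [K], [y] in [L] and
    [(a, b)] in the positive part of the unit ball dual to the l^p norm of the
    plane, is a convex body with the support function of the p-sum, it is the
    p-sum.  Along a parallel chord movement, a point
    [a x - b z] of [K_t +_p (-K_t)] moves at constant speed on a line parallel
    to [v].  Hence, on every line parallel to [v], the chord at time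
    [k t0 + (1 - k) t1] lies in the Minkowski combination of the chords at times
    [t0] and [t1], so its length is a convex function of [t], while the chords
    of [K_t] itself are only translated.  The volume is the integral of the
    chord length (Cavalieri). *)

Require Import Defs.
From mathcomp Require Import all_boot all_order all_algebra.
From mathcomp Require Import all_classical all_reals all_analysis.
From mathcomp Require Import measurable_realfun.
From mathcomp Require Import lra ring.

Set Implicit Arguments.
Unset Strict Implicit.
Unset Printing Implicit Defensive.
Import Order.TTheory GRing.Theory Num.Theory.
Import numFieldNormedType.Exports.
Local Open Scope classical_set_scope.
Local Open Scope ring_scope.

(** * Translation invariance of the Lebesgue measure on tuples *)

Definition translate (R : realType) (c : R) (x : measurableTypeR R) :
  measurableTypeR R := x + c.

Lemma measurable_translate (R : realType) (c : R) :
  measurable_fun setT (translate c).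
Proof. exact: measurable_funD. Qed.

(** By [lebesgue_measure_unique] it suffices that the translated measure agrees with the original on
    half-open intervals, where both are explicit. *)
Lemma lebesgue_measure_translate (R : realType) (c : R)
    (A : set (measurableTypeR R)) : measurable A ->
  lebesgue_measure (translate c @^-1` A) = lebesgue_measure A.
Proof.
move=> mA; apply/esym.
pose m := measure_function_pushforward__canonical__measure_function_Measure
  (@lebesgue_measure R) (measurable_translate c).
suff /(_ A mA) : forall A, measurable A -> lebesgue_measure A = m A by [].
move=> {mA}; apply: lebesgue_measure_unique => // _ [[a b] /= _ <-].
rewrite /m /= /pushforward.
have -> : translate c @^-1` [set` `]a, b]] = [set` `]a - c, b - c]].
  by apply/seteqP; split=> x; rewrite /translate /= !in_itv/= ltrBlDr lerBrDr.
rewrite !lebesgue_measure_itv/= !lte_fin ltrD2r.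
by case: ifP => // _; rewrite -!EFinB opprB addrA subrK.
Qed.

Definition tuple_shift (R : realType) n (c : 'I_n -> R)
    (t : n.-tuple (measurableTypeR R)) : n.-tuple (measurableTypeR R) :=
  [tuple tnth t i + c i | i < n].

Lemma measurable_tuple_shift (R : realType) n (c : 'I_n -> R) :
  measurable_fun setT (tuple_shift c).
Proof.
apply/measurable_fun_tnthP => i.
rewrite (_ : _ \o _ = fun t => tnth t i + c i); last first.
  by apply/funext => t /=; rewrite tnth_mktuple.
apply: (measurableT_comp (measurable_translate (c i))).
exact: measurable_tnth.
Qed.

Lemma tuple_shift_cons (R : realType) n (c : 'I_n.+1 -> R)
    (xt : measurableTypeR R * n.-tuple (measurableTypeR R)) :
  tuple_shift c (cons_pair xt) =
  cons_pair (xt.1 + c ord0, tuple_shift (c \o lift ord0) xt.2).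
Proof.
case: xt => x t; apply: eq_from_tnth => i; rewrite tnth_mktuple.
case: (unliftP ord0 i) => [j ->|->] /=.
  by rewrite !tnthS tnth_mktuple.
by rewrite !(tnth_nth 0).
Qed.

(** Induction on the dimension: through [cons_pair] the shift acts separately on head and tail, so
    the shifted product measure agrees with the original one on rectangles, hence everywhere. *)
Lemma lebesgue_measure_tuple_shift (R : realType) n (c : 'I_n -> R)
    (A : set (n.-tuple (measurableTypeR R))) : measurable A ->
  lebesgue_measure_tuple R n (tuple_shift c @^-1` A) =
  lebesgue_measure_tuple R n A.
Proof.
rewrite /lebesgue_measure_tuple.
elim: n => [|n IHn] in c A * => mA.
  congr (tuple_measure _ _ _); apply/funext => t /=.
  by congr A; apply: eq_from_tnth => -[].
pose f (xt : measurableTypeR R * n.-tuple (measurableTypeR R)) :=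
  (translate (c ord0) xt.1, tuple_shift (c \o lift ord0) xt.2).
have mf : measurable_fun setT f.
  apply/measurable_fun_pairP; split.
    exact: (measurableT_comp (measurable_translate (c ord0)) measurable_fst).
  exact: (measurableT_comp (measurable_tuple_shift _) measurable_snd).
rewrite /= /tuple_measureS /pushforward -comp_preimage.
have -> : tuple_shift c \o @cons_pair _ (measurableTypeR R) n =
    @cons_pair _ _ n \o f.
  by apply/funext => xt /=; rewrite tuple_shift_cons.
rewrite comp_preimage.
set B := cons_pair (n:=n) @^-1` A.
have mB : measurable B.
  by rewrite -[X in measurable X]setTI; exact: measurable_cons_pair.
pose P := (lebesgue_measure (R:=R) \x tuple_measure lebesgue_measure n)%E.
pose m :=
  measure_function_pushforward__canonical__measure_function_Measure P mf.
apply/esym.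
suff /(_ B mB) : forall X, measurable X -> P X = m X by [].
apply: product_measure_unique => // C D mC mD.
rewrite /m /= /pushforward.
have -> : f @^-1` (C `*` D) = (translate (c ord0) @^-1` C) `*`
    (tuple_shift (c \o lift ord0) @^-1` D) by [].
have mC' : measurable (translate (c ord0) @^-1` C).
  by rewrite -[X in measurable X]setTI; exact: measurable_translate.
have mD' : measurable (tuple_shift (c \o lift ord0) @^-1` D).
  by rewrite -[X in measurable X]setTI; exact: measurable_tuple_shift.
rewrite /P product_measure1E//; congr (_ * _)%E; last exact: IHn.
exact: lebesgue_measure_translate.
Qed.

(** * Cavalieri formula along an arbitrary direction *)

(** An open set is the union of the boxes with rational centre and radius [1 / (k + 1)] that it
    contains. These are countably many, and each is a finite intersection of coordinate preimages of
    intervals. *)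
Lemma measurable_open_rV (R : realType) n (U : set 'rV[R]_n) : open U ->
  measurable [set t : n.-tuple (measurableTypeR R) | U (\row_i tnth t i)].
Proof.
move=> oU.
pose box (qk : 'rV[rat]_n * nat) : set 'rV[R]_n :=
  [set y | forall i, `|y ord0 i - ratr (qk.1 ord0 i)| < qk.2.+1%:R^-1].
pose F qk : set (n.-tuple (measurableTypeR R)) :=
  [set t | box qk (\row_i tnth t i) /\ box qk `<=` U].
rewrite (_ : mkset _ = \bigcup_qk F qk); last first.
  apply/seteqP; split=> [t /= Ut|t [qk _ [+ bU]]]; last exact: bU.
  have /nbhs_ballP[e /= e0 eU] : nbhs (\row_i tnth t i : 'rV[R]_n) U.
    exact: open_nbhs_nbhs.
  (* Half of [e] is spent on the distance from the given point to the rational centre, half on the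
     radius of the box. *)
  have e2 : 0 < e / 2 by rewrite divr_gt0.
  have [k ke] : exists k, k.+1%:R^-1 < e / 2 :> R.
    have [k _ /(_ k (leqnn k)) ke] := near_infty_natSinv_lt (PosNum e2).
    by exists k.
  pose d : R := k.+1%:R^-1.
  have d0 : 0 < d by rewrite invr_gt0 ltr0n.
  have /choice[q qE] : forall i, exists q : rat, `|tnth t i - ratr q| < d.
    move=> i; have [|q] := @rat_in_itvoo R (tnth t i - d) (tnth t i + d).
      by rewrite ltrD2l gtrN.
    rewrite in_itv/= => qE; exists q.
    by rewrite distrC ltr_distl.
  exists (\row_i q i, k) => //; split.
    by move=> i; rewrite !mxE; exact: qE.
  move=> y yb; apply: eU; split=> // i j; rewrite ord1 !mxE.
  have := yb j; rewrite /= !mxE => yj; rewrite /ball/=.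
  rewrite (splitr e) -(subrKA (ratr (q j))) (le_lt_trans (ler_normD _ _))//.
  by rewrite ltrD// (lt_trans _ ke)// distrC.
apply: countable_bigcupT_measurable => // qk.
have [bU|nbU] := pselect (box qk `<=` U); last first.
  by rewrite (_ : F qk = set0)//; apply/seteqP; split=> // t [].
rewrite (_ : F qk = \bigcap_(i in [set: 'I_n])
    ((@tnth n (measurableTypeR R) ^~ i) @^-1`
      [set` `]ratr (qk.1 ord0 i) - qk.2.+1%:R^-1,
       ratr (qk.1 ord0 i) + qk.2.+1%:R^-1[])); last first.
  apply/seteqP; split=> [t [tb _] i _|t tb].
    by have := tb i; rewrite mxE /= in_itv/= ltr_distl.
  by split=> // i; have := tb i I; rewrite mxE /= in_itv/= ltr_distl.
apply: fin_bigcap_measurable => // i _.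
rewrite -[X in measurable X]setTI; exact: measurable_tnth.
Qed.

Lemma measurable_compact_rV (R : realType) n (K : set 'rV[R]_n) : compact K ->
  measurable [set t : n.-tuple (measurableTypeR R) | K (\row_i tnth t i)].
Proof.
move=> cK; have clK : closed K.
  by apply: compact_closed => //; exact: norm_hausdorff.
rewrite -[X in measurable X]setCK; apply: measurableC.
exact: (measurable_open_rV (closed_openC clK)).
Qed.

Lemma volume_compact_lty (R : realType) n (K : set 'rV[R]_n) : compact K ->
  (volume K < +oo)%E.
Proof.
move=> cK.
(* The bound holds only for numbers strictly above [M], hence [M + 1]. *)
have [M [_ /(_ (M + 1)%R)]] := compact_bounded cK.
rewrite ltrDl ltr01 => /(_ erefl) KM.
pose A (i : 'I_n) : set (measurableTypeR R) := [set` `[- (M + 1), M + 1]].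
have mA i : measurable (A i) by exact: measurable_itv.
apply: (@le_lt_trans _ _ (lebesgue_measure_tuple R n
    [set t | forall i, A i (tnth t i)])).
  apply: le_measure; rewrite ?inE.
  - exact: measurable_compact_rV.
  - rewrite (_ : mkset _ = \bigcap_(i in [set: 'I_n])
      ((@tnth n (measurableTypeR R) ^~ i) @^-1` A i)); last first.
      by apply/seteqP; split=> [t tA i _|t tA i]; [exact: tA|exact: tA].
    apply: fin_bigcap_measurable => // i _.
    by rewrite -[X in measurable X]setTI; exact: measurable_tnth.
  move=> t /= /KM tM i; rewrite /A /= in_itv/= -ler_norml.
  apply: le_trans tM.
  have -> : tnth t i = (\row_i tnth t i) ord0 i :> R by rewrite mxE.
  rewrite [leRHS]/Num.norm /= mx_normrE.
  by apply/bigmax_geP; right; exists (ord0, i).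
rewrite tuple_measure_box// ltey_eq prode_fin_num// => j _.
suff : (lebesgue_measure (A j : set R)) \is a fin_num by [].
by rewrite /A lebesgue_measure_itv/=; case: ifP.
Qed.

(** * Shear along [v] and integration of chord lengths *)

Definition line_shift (R : realType) n (v : 'rV[R]_n)
    (st : measurableTypeR R * n.-tuple (measurableTypeR R)) :
    n.-tuple (measurableTypeR R) :=
  tuple_shift (fun i => st.1 * v ord0 i) st.2.

Lemma measurable_line_shift (R : realType) n (v : 'rV[R]_n) :
  measurable_fun setT (line_shift v).
Proof.
apply/measurable_fun_tnthP => i.
rewrite (_ : _ \o _ = fun st => tnth st.2 i + st.1 * v ord0 i); last first.
  by apply/funext => t /=; rewrite tnth_mktuple.
apply: (@measurable_funD _ _ R).
  exact: (measurableT_comp (measurable_tnth i) measurable_snd).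
by apply: (@measurable_funM _ _ R) => //; exact: measurable_fst.
Qed.

Lemma row_line_shift (R : realType) n (v : 'rV[R]_n) s t :
  \row_i tnth (line_shift v (s, t)) i = \row_i tnth t i + s *: v :> 'rV[R]_n.
Proof. by apply/rowP => i; rewrite !mxE tnth_mktuple. Qed.

Lemma line_shiftK (R : realType) n (v : 'rV[R]_n) s t :
  line_shift (- v) (s, line_shift v (s, t)) = t.
Proof.
apply: eq_from_tnth => i.
by rewrite !tnth_mktuple /= !mxE mulrN addrK.
Qed.

(** Tonelli for sets: both orders of integration agree on rectangles, which determine the product
    measure. *)
Lemma product_measure12 d1 d2 (T1 : measurableType d1)
    (T2 : measurableType d2) (R : realType)
    (m1 : {sigma_finite_measure set T1 -> \bar R})
    (m2 : {sigma_finite_measure set T2 -> \bar R}) X :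
  measurable X -> (m1 \x m2)%E X = (m1 \x^ m2)%E X.
Proof.
move=> mX.
apply: (@product_measure_unique _ _ _ _ _ m1 m2 (m1 \x^ m2)%E) => // A B mA mB.
exact: product_measure2E.
Qed.

Section fiber.
Context (R : realType) (n : nat) (v : 'rV[R]_n) (i : 'I_n).
Hypothesis vi0 : v ord0 i != 0.
Local Notation mu := (@lebesgue_measure R).
Local Notation mun := (lebesgue_measure_tuple R n).
Local Notation T := (n.-tuple (measurableTypeR R)).

(* Every line parallel to [v] meets the strip in a segment of parameter
   length 1. *)
Definition strip : set T := [set t | 0 <= tnth t i / v ord0 i < 1].

Lemma measurable_strip : measurable strip.
Proof.
rewrite (_ : strip =
    (fun t : T => tnth t i / v ord0 i : R) @^-1` [set` `[0, 1[]).
  rewrite -[X in measurable X]setTI.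
  apply: (measurable_funM (R := R)) => //; exact: measurable_tnth.
by apply/seteqP; split=> t; rewrite /strip /= in_itv.
Qed.

Definition fiber (A : set 'rV[R]_n) (x : 'rV[R]_n) : set (measurableTypeR R) :=
  [set s | A (x + s *: v)].

(** Pairs of a base point in the strip and a parameter leading from it into [A]. The strip replaces
    the hyperplane orthogonal to [v], so that no change of coordinates is needed. *)
Let E (A : set 'rV[R]_n) : set (measurableTypeR R * T) :=
  [set st | A (\row_j tnth (line_shift v st) j) /\ strip st.2].

Let mE A : measurable [set t : T | A (\row_j tnth t j)] -> measurable (E A).
Proof.
move=> mA.
rewrite (_ : E A = line_shift v @^-1` [set t : T | A (\row_j tnth t j)] `&`
  snd @^-1` strip)//.
apply: measurableI; rewrite -[X in measurable X]setTI.
  exact: measurable_line_shift.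
by apply: measurable_snd => //; exact: measurable_strip.
Qed.

(** The integral is the product measure of [E A]. A shear turns [E A] into [E'], whose section over
    a point of [A] is the set of parameters leading back into the strip, an interval of length 1;
    integrating these lengths gives the volume. *)
Lemma volume_fiberE A : measurable [set t : T | A (\row_j tnth t j)] ->
  volume A = (\int[mun]_t (mu \o ysection (E A)) t)%E.
Proof.
move=> mA.
set B := [set t | _] in mA.
transitivity ((mu \x mun)%E (E A)); last first.
  by apply: product_measure12 => //; exact: mE.
pose E' : set (measurableTypeR R * T) :=
  [set st | B st.2 /\ strip (line_shift (- v) st)].
have mE' : measurable E'.
  rewrite (_ : E' = snd @^-1` B `&` line_shift (- v) @^-1` strip)//.
  apply: measurableI; rewrite -[X in measurable X]setTI.
    exact: measurable_snd.
  by apply: measurable_line_shift => //; exact: measurable_strip.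
(* For fixed [s] the [s]-section of [E'] is a translate of that of [E]. *)
transitivity ((mu \x mun)%E E'); last first.
  apply: eq_integral => s _ /=.
  have mx : measurable (xsection E' s) by exact: measurable_xsection.
  rewrite -(lebesgue_measure_tuple_shift (fun j => s * v ord0 j) mx).
  congr (mun _); apply/seteqP; split=> t; rewrite /xsection/= !inE /E' /E/=.
    by rewrite -/(line_shift v (s, t)) line_shiftK.
  by rewrite -/(line_shift v (s, t)) line_shiftK.
rewrite product_measure12//.
transitivity (mun (B `&` setT)); first by rewrite setIT.
rewrite -integral_indic//.
apply: eq_integral => t _ /=; rewrite indicE.
have [Bt|Bt] := boolP (t \in B); last first.
  rewrite (_ : ysection _ _ = set0) ?measure0//.
  apply/seteqP; split=> // s; rewrite /ysection/= inE => -[] /= Bt' _.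
  by case/negP: Bt; exact/mem_set.
(* Moving [t] by [- s *: v] lands in the strip exactly when [0 <= a - s < 1]. *)
pose a : R := tnth t i / v ord0 i.
rewrite (_ : ysection _ _ = [set` `]a - 1, a]]).
  suff -> : lebesgue_measure ([set` `]a - 1, a]] : set R) = 1%:E by [].
  rewrite lebesgue_measure_itv/= lte_fin gtrBl ltr01 -EFinB.
  by rewrite opprB addrC subrK.
have {}Bt : B t by exact: set_mem.
apply/seteqP; split=> s;
  rewrite /ysection/= inE /E' /strip /= tnth_mktuple mxE /=
  in_itv/= mulrDl mulrN mulNr mulfK// -/a subr_ge0 ltrBlDr ltrBlDl.
  by move=> [_ /andP[-> ->]].
by move=> /andP[-> ->].
Qed.

Let ysectionE A t : ysection (E A) t =
  if t \in strip then fiber A (\row_j tnth t j) else set0.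
Proof.
case: ifPn => [/set_mem|/negP] st; apply/seteqP; split=> s //=;
  rewrite /ysection/= inE /E /= row_line_shift.
- by case.
- by split.
- by move=> -[_ /mem_set].
Qed.

(** The inequality between chords is integrated over the strip by [volume_fiberE]; off the strip all
    sections are empty. *)
Lemma volume_fiber_le A B C (a b : R) : compact A -> compact B -> compact C ->
    0 <= a -> 0 <= b ->
    (forall x,
      mu (fiber A x) <= a%:E * mu (fiber B x) + b%:E * mu (fiber C x))%E ->
  (volume A <= a%:E * volume B + b%:E * volume C)%E.
Proof.
move=> cA cB cC a0 b0 ABC.
have mS D : compact D -> measurable_fun setT (mu \o ysection (E D)).
  move=> cD; apply: measurable_fun_ysection; apply: mE.
  exact: measurable_compact_rV.
rewrite !volume_fiberE; try exact: measurable_compact_rV.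
rewrite -!ge0_integralZl//; try exact: mS.
have mB := measurable_funeM a%:E (mS _ cB).
have mC := measurable_funeM b%:E (mS _ cC).
have ge0 D (c : R) t : 0 <= c -> (0 <= c%:E * (mu \o ysection (E D)) t)%E.
  by move=> c0; apply: mule_ge0.
rewrite -ge0_integralD//; try by move=> *; exact: ge0.
apply: ge0_le_integral => //; [exact: mS|exact: emeasurable_funD|].
move=> t _ /=; rewrite !ysectionE; case: ifP => // _.
by rewrite !measure0 !mule0 adde0.
Qed.

Lemma volume_fiber_eq A B : compact A -> compact B ->
  (forall x, mu (fiber A x) = mu (fiber B x)) -> volume A = volume B.
Proof.
move=> cA cB AB; rewrite !volume_fiberE; try exact: measurable_compact_rV.
by apply: eq_integral => t _ /=; rewrite !ysectionE; case: ifP.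
Qed.

End fiber.

(** * Support functions and separation *)

Section dotrv_theory.
Context (R : realType) (n : nat).
Implicit Types (x y u : 'rV[R]_n) (K L M : set 'rV[R]_n).

Lemma dotrvDl x y u : dotrv (x + y) u = dotrv x u + dotrv y u.
Proof. by rewrite -big_split; apply: eq_bigr => i _; rewrite mxE mulrDl. Qed.

Lemma dotrvZl a x u : dotrv (a *: x) u = a * dotrv x u.
Proof.
by rewrite /dotrv mulr_sumr; apply: eq_bigr => i _; rewrite mxE mulrA.
Qed.

Lemma dotrvC x y : dotrv x y = dotrv y x.
Proof. by apply: eq_bigr => i _; rewrite mulrC. Qed.

Lemma dotrvNl x u : dotrv (- x) u = - dotrv x u.
Proof. by rewrite -scaleN1r dotrvZl mulN1r. Qed.

Lemma dotrvBl x y u : dotrv (x - y) u = dotrv x u - dotrv y u.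
Proof. by rewrite dotrvDl dotrvNl. Qed.

Lemma dotrv_ge0 x : 0 <= dotrv x x.
Proof. by apply: sumr_ge0 => i _; rewrite -expr2 sqr_ge0. Qed.

Lemma dotrv_sqrB x y :
  dotrv (x - y) (x - y) = dotrv x x - 2 * dotrv x y + dotrv y y.
Proof.
rewrite dotrvBl ![dotrv _ (x - y)]dotrvC !dotrvBl [dotrv y x]dotrvC; ring.
Qed.

(** Expanding the square leaves [t] times the claim. For small [t] this is the first-order condition
    at a nearest point. *)
Lemma dotrv_sqrB_le x y t : 0 < t ->
  dotrv y y <= dotrv (t *: x - y) (t *: x - y) ->
  2 * dotrv x y <= t * dotrv x x.
Proof.
move=> t0; rewrite dotrv_sqrB !dotrvZl [dotrv x (t *: x)]dotrvC dotrvZl => h.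
rewrite -(ler_pM2l t0); lra.
Qed.

Lemma dotrv_eq0 x : dotrv x x = 0 -> x = 0.
Proof.
move=> /eqP; rewrite psumr_eq0 => [/allP x0|i _]; last first.
  by rewrite -expr2 sqr_ge0.
apply/rowP => i; have := x0 i (mem_index_enum _).
by rewrite -expr2 sqrf_eq0 mxE => /eqP.
Qed.

Lemma continuous_dotrv (f g : 'rV[R]_n -> 'rV[R]_n) :
  continuous f -> continuous g -> continuous (fun x => dotrv (f x) (g x)).
Proof.
move=> cf cg; apply: continuous_big => [|i _]; first exact: add_continuous.
have cc (h : 'rV[R]_n -> 'rV[R]_n) : continuous h ->
    continuous (fun x => h x ord0 i).
  move=> ch x; apply: (@continuous_comp _ _ _ h (fun y => y ord0 i)).
    exact: ch.
  exact: coord_continuous.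
by move=> x; apply: continuousM; [exact: (cc f cf x)|exact: (cc g cg x)].
Qed.

Lemma convex_setP K : convex_set K <->
  forall x y k, 0 <= k <= 1 -> K x -> K y -> K (k *: x + (1 - k) *: y).
Proof.
split=> [cK x y k /andP[k0 k1] /mem_set Kx /mem_set Ky|].
  exact: set_mem (cK x y (Itv01 k0 k1) Kx Ky).
move=> cK x y k /set_mem Kx /set_mem Ky; apply/mem_set/cK => //.
by apply/andP; split.
Qed.

Lemma support_fun_max K u : K !=set0 -> compact K ->
  exists2 x, K x & support_fun K u = dotrv x u /\
    forall y, K y -> dotrv y u <= dotrv x u.
Proof.
move=> K0 cK.
have cu : {within K, continuous (fun x => dotrv x u)}.
  apply: continuous_subspaceT; apply: continuous_dotrv => x; first exact: cvg_id.
  exact: (@cst_continuous 'rV[R]_n 'rV[R]_n u x).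
have [x /set_mem Kx xmax] := EVT_max_rV K0 cK cu.
have {}xmax y : K y -> dotrv y u <= dotrv x u by move=> /mem_set /xmax.
exists x => //; split=> //; apply/eqP; rewrite eq_le; apply/andP; split.
  by apply: ge_sup => [|_ [y Ky <-]]; [exists (dotrv x u), x|exact: xmax].
apply: ub_le_sup; last by exists x.
by exists (dotrv x u) => _ [y Ky <-]; exact: xmax.
Qed.

Lemma support_fun_ub K u x : compact K -> K x -> dotrv x u <= support_fun K u.
Proof.
move=> cK Kx.
have [|y Ky [-> ymax]] := @support_fun_max K u _ cK; first by exists x.
exact: ymax.
Qed.

(* Separation: the outer normal of a putative point outside [M] is given by its
   nearest point in [M]. *)
Lemma convex_body_supportP M x : convex_body M ->
  (forall u, dotrv x u <= support_fun M u) -> M x.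
Proof.
move=> [M0 cM /convex_setP vM] xM.
have cd : {within M, continuous (fun k => dotrv (k - x) (k - x))}.
  apply: continuous_subspaceT; apply: continuous_dotrv => k;
    by apply: (@continuousB R 'rV[R]_n 'rV[R]_n id (cst x) k) => //;
    exact: cst_continuous.
have [k0 /set_mem Mk0 k0min] := EVT_min_rV M0 cM cd.
pose u := x - k0.
have ku k : M k -> dotrv (k - k0) u <= 0.
  move=> Mk; set a := dotrv (k - k0) u; set b := dotrv (k - k0) (k - k0).
  (* The nearest point [k0] is compared with the points of the segment from [k0] to [k]. *)
  have ab t : 0 < t -> t <= 1 -> 2 * a <= t * b.
    move=> t0 t1.
    have := k0min _ (mem_set (vM k k0 t _ Mk Mk0)).
    rewrite (ltW t0) t1 => /(_ isT).
    have -> : t *: k + (1 - t) *: k0 - x = t *: (k - k0) - u.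
      by apply/rowP => i; rewrite !mxE; ring.
    have -> : k0 - x = - u by rewrite opprB.
    by rewrite dotrvNl [dotrv u _]dotrvC dotrvNl opprK => /(dotrv_sqrB_le t0).
  (* If [a] were positive, [t = a / b] would be admissible and give [2 * a <= a]. *)
  rewrite leNgt; apply/negP => a0.
  have b0 : 0 < b by have := ab 1 ltr01 (lexx _); lra.
  have ba : a <= b by have := ab 1 ltr01 (lexx _); lra.
  have := ab (a / b) (divr_gt0 a0 b0); rewrite ler_pdivrMr// mul1r => /(_ ba).
  rewrite divfK ?gt_eqF//; lra.
(* With [y] maximal in direction [u], [dotrv x u <= dotrv y u <= dotrv k0 u], so [dotrv u u <= 0]
   and [x = k0]. *)
have [y My [uE _]] := support_fun_max u M0 cM.
have := xM u; rewrite uE => xy; have := ku _ My; rewrite dotrvBl => yk.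
have : dotrv u u = 0.
  by apply/eqP; rewrite eq_le dotrv_ge0 andbT {1}/u dotrvBl; lra.
by move=> /dotrv_eq0/eqP; rewrite subr_eq0 => /eqP ->.
Qed.

Lemma convex_body_support_inj M M' : convex_body M -> convex_body M' ->
  support_fun M = support_fun M' -> M = M'.
Proof.
move=> bM bM' E; apply/seteqP; split=> x Mx; apply: convex_body_supportP => // u.
  by rewrite -E; apply: support_fun_ub => //; case: bM.
by rewrite E; apply: support_fun_ub => //; case: bM'.
Qed.

End dotrv_theory.

(** * The p-sum as an explicit set *)

Section dual_ball.
Context (R : realType).
Implicit Types (p s t : R).

Definition lp_norm p s t : R := (s `^ p + t `^ p) `^ p^-1.

(** For [p > 1] this is [a^q + b^q <= 1] in the quadrant, with [q] conjugate to [p]; for [p = 1] it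
    is the unit square. Linear inequalities cover both cases and make closedness and convexity
    direct. *)
Definition dual_ball p : set (R * R) :=
  [set ab | [/\ 0 <= ab.1, 0 <= ab.2 & forall s t, 0 <= s -> 0 <= t ->
    ab.1 * s + ab.2 * t <= lp_norm p s t]].

(** Testing against [(1, 0)] and [(0, 1)] confines the set to the unit square, and it is an
    intersection of closed half-planes. *)
Lemma compact_dual_ball p : 1 <= p -> compact (dual_ball p).
Proof.
move=> p1; have p0 : p != 0 by rewrite gt_eqF// (lt_le_trans _ p1).
pose B : set (R * R) := [set` `[0, 1]] `*` [set` `[0, 1]].
have cB : compact B by apply: compact_setX; exact: segment_compact.
have N10 : lp_norm p 1 0 = 1.
  by rewrite /lp_norm powR1 powR0// addr0 powR1.
have N01 : lp_norm p 0 1 = 1.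
  by rewrite /lp_norm powR1 powR0// add0r powR1.
apply: subclosed_compact cB _; last first.
  move=> [a b] [/= a0 b0 ab]; split; rewrite /= in_itv/= ?a0 ?b0/=.
    by have := ab 1 0 ler01 (lexx _); rewrite N10 mulr1 mulr0 addr0.
  by have := ab 0 1 (lexx _) ler01; rewrite N01 mulr1 mulr0 add0r.
pose Q := [set st : R * R | 0 <= st.1 /\ 0 <= st.2].
have -> : dual_ball p = (@fst R R @^-1` [set x | 0 <= x] `&`
    @snd R R @^-1` [set x | 0 <= x]) `&`
    \bigcap_(st in Q) ((fun ab : R * R => ab.1 * st.1 + ab.2 * st.2) @^-1`
        [set x | x <= lp_norm p st.1 st.2]).
  apply/seteqP; split=> [[a b] [/= a0 b0 ab]|[a b] [[/= a0 b0] ab]].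
    by split=> // -[s t] [/= s0 t0]; exact: ab.
  by split=> // s t s0 t0; exact: (ab (s, t)).
apply: closedI; first apply: closedI.
- by apply: preimage_closed; [move=> x _; exact: cvg_fst|exact: closed_ge].
- by apply: preimage_closed; [move=> x _; exact: cvg_snd|exact: closed_ge].
apply: closed_bigI => st _; apply: preimage_closed; last exact: closed_le.
move=> x _; apply: cvgD; apply: cvgM; (try exact: cvg_cst).
  exact: cvg_fst.
exact: cvg_snd.
Qed.

Lemma dual_ball_convex p a b a' b' k : 0 <= k <= 1 ->
  dual_ball p (a, b) -> dual_ball p (a', b') ->
  dual_ball p (k * a + (1 - k) * a', k * b + (1 - k) * b').
Proof.
move=> /andP[k0 k1] [/= a0 b0 ab] [/= a'0 b'0 ab'].
have k1' : 0 <= 1 - k by rewrite subr_ge0.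
split=> /= [||s t s0 t0]; try by rewrite addr_ge0// mulr_ge0.
have h1 := ler_wpM2l k0 (ab _ _ s0 t0).
have h2 := ler_wpM2l k1' (ab' _ _ s0 t0).
lra.
Qed.

(* The witness is the gradient of the l^p norm at (s, t). *)
Lemma dual_ball_attained p s t : 1 <= p -> 0 <= s -> 0 <= t ->
  exists2 ab, dual_ball p ab & ab.1 * s + ab.2 * t = lp_norm p s t.
Proof.
move=> p1 s0 t0; have p0 : 0 < p by rewrite (lt_le_trans _ p1).
have [N0|N0] := eqVneq (lp_norm p s t) 0.
  exists (0, 0); last by rewrite /= !mul0r addr0.
  by split=> //= s' t' _ _; rewrite !mul0r addr0 powR_ge0.
set N := lp_norm p s t in N0 *.
have {}N0 : 0 < N by rewrite lt0r N0 powR_ge0.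
pose a := s / N; pose b := t / N.
have a0 : 0 <= a by rewrite divr_ge0// ltW.
have b0 : 0 <= b by rewrite divr_ge0// ltW.
have ab1 : a `^ p + b `^ p = 1.
  have NV : N^-1 `^ p * (s `^ p + t `^ p) = 1.
    have st : s `^ p + t `^ p = N `^ p.
      by rewrite -powRrM mulVf ?gt_eqF// powRr1// addr_ge0// powR_ge0.
    by rewrite st -powRM ?invr_ge0 ?ltW// mulVf ?gt_eqF// powR1.
  rewrite !powRM ?invr_ge0 ?(ltW N0)//.
  by rewrite -mulrDl mulrC.
have aE : a `^ (p - 1) * a = a `^ p by rewrite mulrC mulr_powRB1.
have bE : b `^ (p - 1) * b = b `^ p by rewrite mulrC mulr_powRB1.
exists (a `^ (p - 1), b `^ (p - 1)) => /=; last first.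
  transitivity ((a `^ p + b `^ p) * N); last by rewrite ab1 mul1r.
  by rewrite -aE -bE mulrDl -!mulrA mulVf ?gt_eqF// !mulr1.
split=> /= [||s' t' s'0 t'0]; try exact: powR_ge0.
(* For [p = 1] there is no finite conjugate exponent. The witness is [(1, 1)] even when [a] or [b]
   vanishes, since a zero exponent gives 1. *)
have [p_eq1|p_neq1] := eqVneq p 1.
  by rewrite p_eq1 subrr !powRr0 !mul1r /lp_norm invr1 !powRr1// addr_ge0.
have {}p1 : 0 < p - 1 by rewrite subr_gt0 lt_neqAle eq_sym p_neq1.
pose q := p / (p - 1).
have q0 : 0 < q by rewrite divr_gt0.
have pq : p^-1 + q^-1 = 1.
  by rewrite /q invf_div; field; rewrite !gt_eqF.
(* As [(p - 1) * q = p], the witness has l^q norm 1 by [ab1], and Hölder gives the bound. *)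
have := hoelder2 s'0 t'0 (powR_ge0 a (p - 1)) (powR_ge0 b (p - 1)) p0 q0 pq.
rewrite -!powRrM (_ : (p - 1) * q = p); last first.
  by rewrite /q mulrC divfK ?gt_eqF.
by rewrite ab1 powR1 mulr1 [s' * _]mulrC [t' * _]mulrC.
Qed.
End dual_ball.

(** * Convexity and support function of the weighted sums *)

Section lp_sum.
Context (R : realType) (n : nat).
Implicit Types (K L : set 'rV[R]_n) (p : R).

(** Normalizing the weights gives a convex combination. This regroups a combination of two points of
    [lp_sum] into one coefficient and one point per body. *)
Lemma convex_weighted K x x' a a' : convex_set K -> K x -> K x' ->
  0 <= a -> 0 <= a' ->
  exists2 x'', K x'' & a *: x + a' *: x' = (a + a') *: x''.
Proof.
move=> /convex_setP vK Kx Kx' a0 a'0.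
have [aa'|aa'] := eqVneq (a + a') 0.
  have [-> ->] : a = 0 /\ a' = 0 by split; lra.
  by exists x => //; rewrite addr0 !scale0r addr0.
have aa'0 : 0 < a + a' by rewrite lt0r aa' addr_ge0.
exists (a / (a + a') *: x + (1 - a / (a + a')) *: x').
  apply: vK => //; rewrite divr_ge0 ?addr_ge0//= ler_pdivrMr// mul1r.
  by rewrite lerDl.
rewrite scalerDr !scalerA mulrBr mulr1 mulrC divfK//.
by rewrite addrAC subrr add0r.
Qed.

Definition lp_sum p K L : set 'rV[R]_n :=
  [set z.1.1 *: z.2.1 + z.1.2 *: z.2.2 | z in dual_ball p `*` (K `*` L)].

Lemma compact_lp_sum p K L : 1 <= p -> compact K -> compact L ->
  compact (lp_sum p K L).
Proof.
move=> p1 cK cL; apply: continuous_compact; last first.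
  by apply: compact_setX; [exact: compact_dual_ball|exact: compact_setX].
apply: continuous_subspaceT => z.
apply: cvgD; apply: cvgZ.
- by apply: cvg_comp; exact: cvg_fst.
- by apply: cvg_comp; [exact: cvg_snd|exact: cvg_fst].
- by apply: cvg_comp; [exact: cvg_fst|exact: cvg_snd].
- by apply: cvg_comp; exact: cvg_snd.
Qed.

Lemma convex_lp_sum p K L : convex_set K -> convex_set L ->
  convex_set (lp_sum p K L).
Proof.
move=> vK vL; apply/convex_setP => _ _ k k01 [[[a b] [x y]] /= [D [Kx Ly]] <-]
  [[[a' b'] [x' y']] /= [D' [Kx' Ly']] <-].
have /andP[k0 k1] := k01.
have k1' : 0 <= 1 - k by rewrite subr_ge0.
have [a0 b0 _] := D; have [a'0 b'0 _] := D'.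
have [x'' Kx'' xE] :=
  convex_weighted vK Kx Kx' (mulr_ge0 k0 a0) (mulr_ge0 k1' a'0).
have [y'' Ly'' yE] :=
  convex_weighted vL Ly Ly' (mulr_ge0 k0 b0) (mulr_ge0 k1' b'0).
exists ((k * a + (1 - k) * a', k * b + (1 - k) * b'), (x'', y'')) => /=.
  by split=> //; exact: dual_ball_convex.
by rewrite -xE -yE !scalerDr !scalerA addrACA.
Qed.

Lemma support_fun_ge0 K u : compact K -> K 0 -> 0 <= support_fun K u.
Proof.
move=> cK K0; have := support_fun_ub u cK K0.
by rewrite -(scale0r u) dotrvZl mul0r.
Qed.

(** The support function is the maximum of [a * support_fun K u + b * support_fun L u] over
    [dual_ball p], which duality identifies with the l^p norm. Containing the origin makes both
    support functions nonnegative, as [dual_ball] requires of its test pairs. *)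
Lemma is_psum_lp_sum p K L : 1 <= p -> convex_body K -> convex_body L ->
  K 0 -> L 0 -> is_psum p K L (lp_sum p K L).
Proof.
move=> p1 [_ cK vK] [_ cL vL] K0 L0.
have [Kn Ln] : K !=set0 /\ L !=set0 by split; exists 0.
have cM := compact_lp_sum p1 cK cL.
have hM u : exists2 x, lp_sum p K L x &
    dotrv x u = lp_norm p (support_fun K u) (support_fun L u).
  have [x Kx [xE _]] := support_fun_max u Kn cK.
  have [y Ly [yE _]] := support_fun_max u Ln cL.
  have [ab Dab abE] := dual_ball_attained p1 (support_fun_ge0 u cK K0)
    (support_fun_ge0 u cL L0).
  exists (ab.1 *: x + ab.2 *: y); first by exists (ab, (x, y)).
  by rewrite dotrvDl !dotrvZl -xE -yE.
split.
  split=> //; last exact: convex_lp_sum.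
  by have [x Mx _] := hM 0; exists x.
move=> u; rewrite -/(lp_norm _ _ _).
apply/eqP; rewrite eq_le; apply/andP; split.
  have [|_ [[[a b] [x y]] /= [Dab [Kx Ly]] <-] [-> _]] :=
    @support_fun_max _ _ _ u _ cM.
    by have [x Mx _] := hM 0; exists x.
  rewrite dotrvDl !dotrvZl; have [/= a0 b0 ab] := Dab.
  apply: le_trans (ab _ _ (support_fun_ge0 u cK K0) (support_fun_ge0 u cL L0)).
  by apply: lerD; apply: ler_wpM2l => //; exact: support_fun_ub.
by have [x Mx <-] := hM u; exact: support_fun_ub.
Qed.

(** [lp_sum] shows that [get] has a witness, and a convex body is determined by its support
    function. *)
Lemma psumE p K L : 1 <= p -> convex_body K -> convex_body L ->
  K 0 -> L 0 -> psum p K L = lp_sum p K L.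
Proof.
move=> p1 bK bL K0 L0; have [bM hM] := is_psum_lp_sum p1 bK bL K0 L0.
have [bP hP] : is_psum p K L (psum p K L).
  by apply: getPex; exists (lp_sum p K L).
by apply: convex_body_support_inj => //; apply/funext => u; rewrite hM hP.
Qed.

End lp_sum.

(** * Chords along the movement *)

Lemma lebesgue_measure_interval (R : realType) (S : set R) :
  is_interval S -> S !=set0 -> has_ubound S -> has_lbound S ->
  lebesgue_measure (S : set (measurableTypeR R)) = (sup S - inf S)%:E.
Proof.
move=> iS S0 uS lS.
have le_is : inf S <= sup S.
  have [x Sx] := S0; apply: (@le_trans _ _ x); first exact: ge_inf.
  exact: ub_le_sup.
have -> : S = [set` Rhull S] by apply/is_intervalP.
suff : lebesgue_measure ([set` Rhull S] : set R) = (sup S - inf S)%:E.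
  by rewrite -((is_intervalP S).1 iS).
rewrite lebesgue_measure_itv /Rhull (asboolT uS) (asboolT lS) /= lte_fin -EFinB.
case: ifPn => //; rewrite -leNgt => le_si.
have -> : sup S = inf S by apply/eqP; rewrite eq_le le_is le_si.
by rewrite subrr.
Qed.

(** The decomposition bounds [sup S] above and [inf S] below by the same combinations of those of
    [S0] and [S1]. *)
Lemma lebesgue_measure_Minkowski (R : realType) (S S0 S1 : set R) (k : R) :
    0 <= k <= 1 -> is_interval S -> is_interval S0 -> is_interval S1 ->
    has_ubound S0 -> has_lbound S0 -> has_ubound S1 -> has_lbound S1 ->
    (forall s, S s ->
      exists s0 s1, [/\ S0 s0, S1 s1 & s = k * s0 + (1 - k) * s1]) ->
  (lebesgue_measure (S : set (measurableTypeR R)) <=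
   k%:E * lebesgue_measure (S0 : set (measurableTypeR R)) +
   (1 - k)%:E * lebesgue_measure (S1 : set (measurableTypeR R)))%E.
Proof.
move=> /andP[k0 k1] iS iS0 iS1 u0 l0 u1 l1 SE.
have k1' : 0 <= 1 - k by rewrite subr_ge0.
(* Empty [S] is set apart, since [sup] and [inf] are meaningful only on non-empty sets; a point of
   [S] also yields points of [S0] and [S1]. *)
have [S_eq0|/set0P[s Ss]] := eqVneq S set0.
  by rewrite S_eq0 measure0 adde_ge0// mule_ge0.
have [s0 [s1 [Ss0 Ss1 _]]] := SE s Ss.
have nS0 : S0 !=set0 by exists s0.
have nS1 : S1 !=set0 by exists s1.
have ubS : ubound S (k * sup S0 + (1 - k) * sup S1).
  move=> _ /SE[r0 [r1 [Sr0 Sr1 ->]]].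
  by apply: lerD; apply: ler_wpM2l => //; exact: ub_le_sup.
have lbS : lbound S (k * inf S0 + (1 - k) * inf S1).
  move=> _ /SE[r0 [r1 [Sr0 Sr1 ->]]].
  by apply: lerD; apply: ler_wpM2l => //; exact: ge_inf.
have nS : S !=set0 by exists s.
rewrite !lebesgue_measure_interval//; last 2 first.
- by exists (k * sup S0 + (1 - k) * sup S1).
- by exists (k * inf S0 + (1 - k) * inf S1).
rewrite -!EFinM -EFinD lee_fin.
have := ge_sup nS ubS; have := lb_le_inf nS lbS; lra.
Qed.

(** * Chords of convex sets and their motion *)

Section fiber_interval.
Context (R : realType) (n : nat).
Implicit Types (K M : set 'rV[R]_n) (v x : 'rV[R]_n).

Lemma is_interval_fiber M v x : convex_set M -> is_interval (fiber v M x).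
Proof.
move=> /convex_setP vM a b; rewrite /fiber /= => Ma Mb c /andP[ac cb].
have [ab|ab] := eqVneq a b.
  by have -> : c = a by apply/eqP; rewrite eq_le ac ab cb.
have ab0 : 0 < b - a by rewrite subr_gt0 lt_neqAle ab (le_trans ac).
have := vM _ _ ((b - c) / (b - a)) _ Ma Mb.
rewrite divr_ge0 ?(ltW ab0) ?subr_ge0//= ler_pdivrMr// mul1r lerD2l lerN2 ac.
move=> /(_ isT); congr M; apply/rowP => i; rewrite !mxE.
by field; rewrite gt_eqF.
Qed.

Lemma dotrv_gt0 v : v != 0 -> 0 < dotrv v v.
Proof.
move=> v0; rewrite lt0r dotrv_ge0 andbT.
by apply: contra_neq v0; exact: dotrv_eq0.
Qed.

(** Pairing [x + s *: v] with [v] gives at most [support_fun M v], an inequality solved for [s]. *)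
Lemma has_ubound_fiber M v x : v != 0 -> compact M -> has_ubound (fiber v M x).
Proof.
move=> /dotrv_gt0 v0 cM.
exists ((support_fun M v - dotrv x v) / dotrv v v) => s Ms.
rewrite ler_pdivlMr// lerBrDl -dotrvZl -dotrvDl; exact: support_fun_ub.
Qed.

Lemma has_lbound_fiber M v x : v != 0 -> compact M -> has_lbound (fiber v M x).
Proof.
rewrite -oppr_eq0 => v0 cM; have [b bP] := has_ubound_fiber x v0 cM.
exists (- b) => s Ms; rewrite lerNl; apply: bP.
by rewrite /fiber /= scaleNr scalerN opprK.
Qed.

Lemma hyperproj_line v x s : v != 0 -> hyperproj v (x + s *: v) = hyperproj v x.
Proof.
move=> /dotrv_gt0 v0; rewrite /hyperproj dotrvDl dotrvZl mulrDl mulfK ?gt_eqF//.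
by rewrite scalerDl opprD addrACA subrr addr0.
Qed.

Definition chord_shift (K : set 'rV[R]_n) v (beta : 'rV[R]_n -> R) t :=
  [set x + (beta (hyperproj v x) * t) *: v | x in K].

(** [hyperproj v] is constant on a line parallel to [v], so the whole chord is translated by the
    same [c]. *)
Lemma measure_fiber_chord_shift K v beta t x : v != 0 -> convex_set K ->
  lebesgue_measure (fiber v (chord_shift K v beta t) x) =
  lebesgue_measure (fiber v K x).
Proof.
move=> v0 vK; set c := beta (hyperproj v x) * t.
have mK : measurable (fiber v K x).
  exact: (@is_interval_measurable R _ (is_interval_fiber vK)).
rewrite -[RHS](lebesgue_measure_translate (- c) mK).
congr (lebesgue_measure _); apply/seteqP; split=> s; rewrite /fiber /=.
  move=> [y Ky /(canRL (addrK _)) yE].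
  suff -> : x + (s - c) *: v = y by [].
  have hE : hyperproj v y = hyperproj v x.
    by rewrite yE -addrA -scalerBl hyperproj_line.
  by rewrite yE hE -/c scalerBl addrA.
move=> Ks; exists (x + (s - c) *: v) => //.
by rewrite hyperproj_line// -/c -addrA -scalerDl subrK.
Qed.

Lemma fiber_lp_sum_chord_shift K v beta p k t0 t1 x s :
  let S t := fiber v (lp_sum p (chord_shift K v beta t)
    (reflection (chord_shift K v beta t))) x in
  S (k * t0 + (1 - k) * t1) s ->
  exists s0 s1, [/\ S t0 s0, S t1 s1 & s = k * s0 + (1 - k) * s1].
Proof.
move=> S [[[a b] [y z]] /= [Dab [[y' Ky <-] [_ [z' Kz <-] <-]]] xE].
(* The speed of the point along its line; the minus sign comes from the reflection. *)
pose g := a * beta (hyperproj v y') - b * beta (hyperproj v z').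
pose t := k * t0 + (1 - k) * t1.
have St r : S r (s + (r - t) * g).
  exists ((a, b), (y' + (beta (hyperproj v y') * r) *: v,
     - (z' + (beta (hyperproj v z') * r) *: v))) => /=.
    split=> //; split; first by exists y'.
    by exists (z' + (beta (hyperproj v z') * r) *: v) => //; exists z'.
  rewrite scalerDl addrA -xE -/t /g; apply/rowP => i; rewrite !mxE; ring.
(* The displacements cancel because [k * (t0 - t) + (1 - k) * (t1 - t) = 0]. *)
exists (s + (t0 - t) * g), (s + (t1 - t) * g); split=> //.
by rewrite /t; ring.
Qed.

End fiber_interval.

(** * Convexity of the volume ratio *)

Lemma convex_body_reflection (R : realType) n (K : set 'rV[R]_n) :
  convex_body K -> convex_body (reflection K).
Proof.
move=> [[x Kx] cK /convex_setP vK]; split; first by exists (- x), x.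
  apply: continuous_compact cK; apply: continuous_subspaceT => y.
  exact: opp_continuous.
apply/convex_setP => _ _ k k01 [y Ky <-] [z Kz <-].
by exists (k *: y + (1 - k) *: z); [exact: vK|rewrite opprD !scalerN].
Qed.

Theorem proposition3p1 (R : realType) (n : nat) (p : R) (I : set R)
    (Kt : R -> set 'rV[R]_n)
    (p_ge1 : 1 <= p)
    (I_itv : is_interval I)
    (Kt_pcm : parallel_chord_movement I Kt)
    (Kt_body0 : forall t, I t -> convex_body0 (Kt t)) :
  @convex_function R R^o I (fun t => Fp p (Kt t)).
Proof.
have [K [v [beta [[_ cK vK] v0 _ KtE]]]] := Kt_pcm.
have /rV0Pn[i vi0] := v0.
have Ktb t : I t -> convex_body (Kt t) by move=> /Kt_body0[].
have Kt0 t : I t -> Kt t 0 by move=> /Kt_body0[].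
have KtS t : I t -> Kt t = chord_shift K v beta t by move=> /KtE[].
pose M t := lp_sum p (Kt t) (reflection (Kt t)).
have Mb t : I t -> convex_body (M t).
  move=> It; have Kb := Ktb t It.
  apply: (is_psum_lp_sum p_ge1 Kb (convex_body_reflection Kb) _ _).1.
    exact: Kt0.
  by exists 0; [exact: Kt0|rewrite oppr0].
(* The denominator is constant in time because chords of [K] are only translated. *)
have FpE t : I t -> Fp p (Kt t) = fine (volume (M t)) / fine (volume K).
  move=> It; rewrite /Fp psumE//; last 4 first.
  - exact: Ktb.
  - exact/convex_body_reflection/Ktb.
  - exact: Kt0.
  - by exists 0; [exact: Kt0|rewrite oppr0].
  congr (_ / fine _); apply: (volume_fiber_eq vi0) => //.
    by have [] := Ktb t It.
  by move=> x; rewrite KtS// measure_fiber_chord_shift.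
(* Finite volumes allow passing between the real and the extended inequality. *)
have finM t : I t -> volume (M t) = (fine (volume (M t)))%:E.
  move=> It; rewrite fineK// ge0_fin_numE; last exact: measure_ge0.
  by apply: volume_compact_lty; have [] := Mb t It.
suff main (k t0 t1 : R) : 0 <= k -> k <= 1 -> I t0 -> I t1 ->
    Fp p (Kt (k * t0 + (1 - k) * t1)) <=
    k * Fp p (Kt t0) + (1 - k) * Fp p (Kt t1).
  move=> k t0 t1 /set_mem It0 /set_mem It1.
  by apply: main => //; rewrite ?ge0 ?le1.
move=> k0 k1 It0 It1; set t := _ + _.
(* [t] lies between [t0] and [t1], whose order is not prescribed. *)
have It : I t.
  have [le01|/ltW le10] := leP t0 t1.
    by apply: (I_itv _ _ It0 It1); rewrite /t; apply/andP; split; nra.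
  by apply: (I_itv _ _ It1 It0); rewrite /t; apply/andP; split; nra.
rewrite !FpE// !mulrA -mulrDl; apply: ler_wpM2r.
  by rewrite invr_ge0 fine_ge0// measure_ge0.
rewrite -lee_fin EFinD !EFinM -!finM//.
have [_ cM vM] := Mb t It; have [_ cM0 vM0] := Mb t0 It0.
have [_ cM1 vM1] := Mb t1 It1.
apply: (volume_fiber_le vi0) => //; first by rewrite subr_ge0.
move=> x; apply: lebesgue_measure_Minkowski => //; first (by rewrite k0);
  try exact: is_interval_fiber.
- exact: has_ubound_fiber.
- exact: has_lbound_fiber.
- exact: has_ubound_fiber.
- exact: has_lbound_fiber.
rewrite /M !KtS// => s; exact: fiber_lp_sum_chord_shift.
Qed.
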